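(* The axiomatic theory $\mathrm{ISV}$ is sound with respect to fixed-point structures of the scheme $\mathrm{SVI}$: if $\mathcal M$ is a fixed-point structure of $\mathrm{SVI}$ (i.e. a structure such that for every $w\in W_{\mathcal M}$ the set $X=\mathcal I_{\mathcal M}(w)$ satisfies $X=\mathcal J_{\mathrm{svi}}(X)$), then $\mathcal M\vDash \mathrm{ISV}$, i.e. every axiom of $\mathrm{ISV}$ is forced at every world of $\mathcal M$.
   Context: **Language.** $\mathcal L_{\mathbb N}$ is the language of Heyting arithmetic $\mathrm{HA}$ (logical symbols $\bot,\to,\vee,\wedge,\forall,\exists$; $\neg A$ is $A\to\bot$), with finitely many additional function symbols for primitive recursive functions. $\mathcal L_{\mathrm{Tr}}=\mathcal L_{\mathbb N}\cup\{\mathrm{Tr}\}$ with $\mathrm{Tr}$ a unary predicate. Fix a standard Gödel numbering; $\#\varphi$ is the code of $\varphi$, $\ulcorner\varphi\urcorner$ the numeral of the code, $\bar n$ the numeral of $n$, $t^{\mathbb N}$ the value of a closed term $t$ in the standard model. $\mathrm{SENT}\subseteq\omega$ is the set of codes of sentences of $\mathcal L_{\mathrm{Tr}}$. **Structures.** A *structure* (persistent first-order intuitionistic Kripke $\omega$-structure) is $\mathcal M=\langle W_{\mathcal M},\le_{\mathcal M},\mathcal D_{\mathcal M},\mathcal I_{\mathcal M}\rangle$ with $W_{\mathcal M}$ a set (of worlds), $\le_{\mathcal M}$ a partial order on it, $\mathcal D_{\mathcal M}$ assigning the domain $\omega$ to each world, and $\mathcal I_{\mathcal M}\subseteq W_{\mathcal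 M}\times\mathrm{SENT}$ such that $u\le_{\mathcal M}v$ and $\langle u,x\rangle\in\mathcal I_{\mathcal M}$ imply $\langle v,x\rangle\in\mathcal I_{\mathcal M}$. Write $\mathcal I_{\mathcal M}(w)=\{x:\langle w,x\rangle\in\mathcal I_{\mathcal M}\}$. **Forcing** $w\Vdash_{\mathcal M}A$ for sentences $A$ of $\mathcal L_{\mathrm{Tr}}$: $w\nVdash\bot$; an atomic arithmetical sentence is forced iff true in $\mathbb N$; $w\Vdash\mathrm{Tr}(s)$ iff $s^{\mathbb N}\in\mathcal I_{\mathcal M}(w)$; $\wedge,\vee$ are evaluated at $w$ in the usual way; $w\Vdash A\to B$ iff for all $w'\ge w$, $w'\Vdash A$ implies $w'\Vdash B$; $w\Vdash\exists xA$ iff $w\Vdash A(\bar n)$ for some $n\in\omega$; $w\Vdash\forall xA$ iff $w'\Vdash A(\bar n)$ for all $w'\ge w$ and all $n\in\omega$. $\mathcal M\vDash A$ iff $w\Vdash_{\mathcal M}A$ for all $w\in W_{\mathcal M}$. **Embeddings.** $f:W_{\mathcal M}\to W_{\mathcal M'}$ is an embedding-interpretation function, written $\mathcal I_{\mathcal M}\leqq_f\mathcal I_{\mathcal M'}$, iff $f$ is injective, $w_0\le_{\mathcal M}w_1\Leftrightarrow f(w_0)\le_{\mathcal M'}f(w_1)$, and $\mathcal I_{\mathcal M}(w)\subseteq\mathcal I_{\mathcal M'}(f(w))$ for all $w$. **Supervaluation.** $w\Vdash^{\mathcal M}_{\mathrm{svi}}\varphi$ iff for all structures $\mathcal M'$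 and all $f$ with $\mathcal I_{\mathcal M}\leqq_f\mathcal I_{\mathcal M'}$, $f(w)\Vdash_{\mathcal M'}\varphi$. For $X\subseteq\mathrm{SENT}$: $\mathcal J_{\mathrm{svi}}(X)=\{\#\varphi\in\mathrm{SENT} : \forall\mathcal M\,\forall w\in W_{\mathcal M}(\mathcal I_{\mathcal M}(w)=X\Rightarrow w\Vdash^{\mathcal M}_{\mathrm{svi}}\varphi)\}$. **The theory.** $\mathrm{HAT}$ is $\mathrm{HA}$ (Peano axioms over intuitionistic predicate logic with equality) formulated in $\mathcal L_{\mathrm{Tr}}$ with induction for all formulas of $\mathcal L_{\mathrm{Tr}}$. $\mathrm{Ax}_{\mathrm{HAT}}(x)$ represents ''$x$ is the code of a (closed) axiom of $\mathrm{HAT}$''; $\mathrm{Sent}(x)$ represents $\mathrm{SENT}$. Dotted symbols stand for the primitive recursive syntactic operations on codes (e.g. $x\mathbin{\underset{\cdot}{\to}}y$ is the code of the conditional of the formulas coded by $x,y$; $\underset{\cdot}{\mathrm{Tr}}\,t$ is the code of $\mathrm{Tr}(t)$ for the term coded by $t$); $x(t/v)$ is substitution; $\ulcorner\varphi(\dot x)\urcorner$ is the code of $\varphi$ with the numeral of $x$ substituted; $t^\circ$ is the value of the closed term coded by $t$; quantifiers $\forall s,\forall t$ range over codes of closed terms. $\mathrm{ISV}$ extends $\mathrm{HAT}$ by: (ISV1) $\forall s,t\,((\mathrm{Tr}(s\underset{\cdot}{=}t)\leftrightarrow s^\circ=t^\circ)\wedge(\mathrm{Tr}(s\underset{\cdot}{\ne}t)\leftrightarrow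 s^\circ\neq t^\circ))$; (ISV2) $\forall x(\mathrm{Ax}_{\mathrm{HAT}}(x)\to\mathrm{Tr}\,x)$; (ISV3) $\forall x,v\,(\mathrm{Sent}(\underset{\cdot}{\forall}vx)\to((\forall t\,\mathrm{Tr}\,x(t/v))\to\mathrm{Tr}(\underset{\cdot}{\forall}vx)))$; (ISV4) $\forall t(\mathrm{Tr}\,t^\circ\to\mathrm{Tr}\,\underset{\cdot}{\mathrm{Tr}}\,t)$; (ISV5) $\forall x,y\,(\mathrm{Sent}(x\underset{\cdot}{\to}y)\to(\mathrm{Tr}(x\underset{\cdot}{\to}y)\to(\mathrm{Tr}\,x\to\mathrm{Tr}\,y)))$; (ISV6) $\forall x\,\mathrm{Tr}\ulcorner\mathrm{Tr}(\dot x)\to\mathrm{Sent}(\dot x)\urcorner$; (ISV7) $\mathrm{Tr}\ulcorner\varphi\urcorner\to\varphi$ for every sentence $\varphi$ of $\mathcal L_{\mathrm{Tr}}$. *)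

(* Defs.v *)
From mathcomp Require Import all_boot.

Set Implicit Arguments.
Unset Strict Implicit.
Unset Printing Implicit Defensive.

(** * Language *)

(* [Fn i ts] is the i-th additional primitive recursive function symbol
   applied to [ts]. *)
Inductive tm : Type :=
  | Var of nat
  | Zero
  | Succ of tm
  | Add of tm & tm
  | Mul of tm & tm
  | Fn of nat & seq tm.

Inductive form : Type :=
  | Bot
  | Eq of tm & tm
  | Tr of tm
  | And of form & form
  | Or of form & form
  | Imp of form & form
  | All of nat & form
  | Ex of nat & form.

Definition Not A := Imp A Bot.
Definition Iff A B := And (Imp A B) (Imp B A).

Fixpoint numeral (n : nat) : tm := if n is m.+1 then Succ (numeral m) else Zero.

Fixpoint fv_t (t : tm) : seq nat :=
  match t with
  | Var v => [:: v]
  | Zero => [::]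
  | Succ s => fv_t s
  | Add s u | Mul s u => fv_t s ++ fv_t u
  | Fn _ ts => flatten (map fv_t ts)
  end.

Fixpoint fv (A : form) : seq nat :=
  match A with
  | Bot => [::]
  | Eq s t => fv_t s ++ fv_t t
  | Tr s => fv_t s
  | And B C | Or B C | Imp B C => fv B ++ fv C
  | All v B | Ex v B => [seq u <- fv B | u != v]
  end.

Fixpoint all_vars (A : form) : seq nat :=
  match A with
  | Bot => [::]
  | Eq s t => fv_t s ++ fv_t t
  | Tr s => fv_t s
  | And B C | Or B C | Imp B C => all_vars B ++ all_vars C
  | All v B | Ex v B => v :: all_vars B
  end.

Fixpoint tsubst (v : nat) (r : tm) (t : tm) : tm :=
  match t with
  | Var u => if u == v then r else Var u
  | Zero => Zero
  | Succ s => Succ (tsubst v r s)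
  | Add s u => Add (tsubst v r s) (tsubst v r u)
  | Mul s u => Mul (tsubst v r s) (tsubst v r u)
  | Fn i ts => Fn i (map (tsubst v r) ts)
  end.

(* Replacement of the free occurrences of [v] by [r], without renaming of bound
   variables; it is only used when [free_for r v A] holds. *)
Fixpoint fsubst (v : nat) (r : tm) (A : form) : form :=
  match A with
  | Bot => Bot
  | Eq s t => Eq (tsubst v r s) (tsubst v r t)
  | Tr s => Tr (tsubst v r s)
  | And B C => And (fsubst v r B) (fsubst v r C)
  | Or B C => Or (fsubst v r B) (fsubst v r C)
  | Imp B C => Imp (fsubst v r B) (fsubst v r C)
  | All u B => if u == v then All u B else All u (fsubst v r B)
  | Ex u B => if u == v then Ex u B else Ex u (fsubst v r B)
  end.

Fixpoint free_for (r : tm) (v : nat) (A : form) : bool :=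
  match A with
  | Bot | Eq _ _ | Tr _ => true
  | And B C | Or B C | Imp B C => free_for r v B && free_for r v C
  | All u B | Ex u B =>
      [|| u == v, v \notin fv B | (u \notin fv_t r) && free_for r v B]
  end.

(* Formulas of the arithmetical language, without the truth predicate. *)
Fixpoint arith (A : form) : bool :=
  match A with
  | Bot | Eq _ _ => true
  | Tr _ => false
  | And B C | Or B C | Imp B C => arith B && arith C
  | All _ B | Ex _ B => arith B
  end.

(** * Primitive recursive function symbols *)

(* [Expl n t] introduces an n-ary symbol by
     f (x_0, .., x_{n-1}) = t,
   [Rec n b s] introduces an (n+1)-ary symbol by
     f (x_0, .., x_{n-1}, 0) = b
     f (x_0, .., x_{n-1}, S x_n) = s [x_{n+1} := f (x_0, .., x_{n-1}, x_n)],
   where x_i is [Var i].  A signature is a finite list of definitions, each of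
   which may only use the symbols introduced before it. *)
Inductive fdef : Type :=
  | Expl of nat & tm
  | Rec of nat & tm & tm.

Definition signature := seq fdef.

Definition arity (d : fdef) : nat :=
  match d with Expl n _ => n | Rec n _ _ => n.+1 end.

Definition sdef (Sig : signature) (i : nat) : fdef := nth (Expl 0 Zero) Sig i.

Fixpoint term_in (Sig : signature) (t : tm) : bool :=
  match t with
  | Var _ | Zero => true
  | Succ s => term_in Sig s
  | Add s u | Mul s u => term_in Sig s && term_in Sig u
  | Fn i ts => [&& i < size Sig, size ts == arity (sdef Sig i)
                 & all (term_in Sig) ts]
  end.

Fixpoint form_in (Sig : signature) (A : form) : bool :=
  match A with
  | Bot => true
  | Eq s t => term_in Sig s && term_in Sig t
  | Tr s => term_in Sig s
  | And B C | Or B C | Imp B C => form_in Sig B && form_in Sig C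
  | All _ B | Ex _ B => form_in Sig B
  end.

Definition wf_def (Sig : signature) (d : fdef) : bool :=
  match d with
  | Expl n t => term_in Sig t && all (fun v => v < n) (fv_t t)
  | Rec n b s => [&& term_in Sig b, all (fun v => v < n) (fv_t b),
                     term_in Sig s & all (fun v => v < n.+2) (fv_t s)]
  end.

Definition wf_signature (Sig : signature) : Prop :=
  forall i, i < size Sig -> wf_def (take i Sig) (sdef Sig i).

Fixpoint tval (F : seq (seq nat -> nat)) (rho : nat -> nat) (t : tm) : nat :=
  match t with
  | Var v => rho v
  | Zero => 0
  | Succ s => (tval F rho s).+1
  | Add s u => tval F rho s + tval F rho u
  | Mul s u => tval F rho s * tval F rho u
  | Fn i ts => nth (fun=> 0) F i (map (tval F rho) ts)
  end.

Definition fdef_fun (F : seq (seq nat -> nat)) (d : fdef) (args : seq nat) : nat :=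
  match d with
  | Expl n t => tval F (nth 0 args) t
  | Rec n b s =>
      let xs := take n args in
      iteri (nth 0 args n)
            (fun y r => tval F (nth 0 (xs ++ [:: y; r])) s)
            (tval F (nth 0 xs) b)
  end.

Definition interp (Sig : signature) : seq (seq nat -> nat) :=
  foldl (fun F d => rcons F (fdef_fun F d)) [::] Sig.

Definition value (Sig : signature) (rho : nat -> nat) (t : tm) : nat :=
  tval (interp Sig) rho t.

Definition closed_term (Sig : signature) (t : tm) : bool :=
  term_in Sig t && (fv_t t == [::]).

Definition cvalue (Sig : signature) (t : tm) : nat := value Sig (fun=> 0) t.

Definition sentence (Sig : signature) (A : form) : bool :=
  form_in Sig A && (fv A == [::]).

(** * Gödel numbering *)

Fixpoint tcode (t : tm) : nat :=
  match t with
  | Var v => CodeSeq.code [:: 0; v]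
  | Zero => CodeSeq.code [:: 1]
  | Succ s => CodeSeq.code [:: 2; tcode s]
  | Add s u => CodeSeq.code [:: 3; tcode s; tcode u]
  | Mul s u => CodeSeq.code [:: 4; tcode s; tcode u]
  | Fn i ts => CodeSeq.code [:: 5, i & map tcode ts]
  end.

Definition c_bot : nat := CodeSeq.code [:: 6].
Definition c_eq (x y : nat) : nat := CodeSeq.code [:: 7; x; y].
Definition c_tr (x : nat) : nat := CodeSeq.code [:: 8; x].
Definition c_and (x y : nat) : nat := CodeSeq.code [:: 9; x; y].
Definition c_or (x y : nat) : nat := CodeSeq.code [:: 10; x; y].
Definition c_imp (x y : nat) : nat := CodeSeq.code [:: 11; x; y].
Definition c_all (v x : nat) : nat := CodeSeq.code [:: 12; v; x].
Definition c_ex (v x : nat) : nat := CodeSeq.code [:: 13; v; x].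
Definition c_neq (x y : nat) : nat := c_imp (c_eq x y) c_bot.

Fixpoint fcode (A : form) : nat :=
  match A with
  | Bot => c_bot
  | Eq s t => c_eq (tcode s) (tcode t)
  | Tr s => c_tr (tcode s)
  | And B C => c_and (fcode B) (fcode C)
  | Or B C => c_or (fcode B) (fcode C)
  | Imp B C => c_imp (fcode B) (fcode C)
  | All v B => c_all (tcode (Var v)) (fcode B)
  | Ex v B => c_ex (tcode (Var v)) (fcode B)
  end.

Definition SENT (Sig : signature) (x : nat) : Prop :=
  exists2 A, sentence Sig A & x = fcode A.

(** * Kripke structures and forcing *)

Record structure (Sig : signature) : Type := Structure {
  world :> Type;
  wle : world -> world -> Prop;
  wle_refl : forall u, wle u u;
  wle_trans : forall u v w, wle u v -> wle v w -> wle u w;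
  wle_antisym : forall u v, wle u v -> wle v u -> u = v;
  itp : world -> nat -> Prop;
  itp_sent : forall w x, itp w x -> SENT Sig x;
  itp_persistent : forall u v x, wle u v -> itp u x -> itp v x
}.

Definition upd (rho : nat -> nat) (v n : nat) : nat -> nat :=
  fun u => if u == v then n else rho u.

(* The sentence A(n) with the numeral of n substituted for v is represented by A
   under the assignment [upd rho v n]. *)
Fixpoint forces_at (Sig : signature) (M : structure Sig) (w : M)
    (rho : nat -> nat) (A : form) : Prop :=
  match A with
  | Bot => False
  | Eq s t => value Sig rho s = value Sig rho t
  | Tr s => itp w (value Sig rho s)
  | And B C => forces_at w rho B /\ forces_at w rho C
  | Or B C => forces_at w rho B \/ forces_at w rho C
  | Imp B C => forall w', wle w w' -> forces_at w' rho B -> forces_at w' rho C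
  | Ex v B => exists n, forces_at w (upd rho v n) B
  | All v B => forall w', wle w w' -> forall n, forces_at w' (upd rho v n) B
  end.

Definition forces (Sig : signature) (M : structure Sig) (w : M) (A : form) : Prop :=
  forces_at w (fun=> 0) A.

Definition models (Sig : signature) (M : structure Sig) (A : form) : Prop :=
  forall w : M, forces w A.

(** * Supervaluation *)

Definition embedding (Sig : signature) (M M' : structure Sig) (f : M -> M') : Prop :=
  [/\ injective f,
      forall u v, wle u v <-> wle (f u) (f v)
    & forall w x, itp w x -> itp (f w) x].

Definition svi (Sig : signature) (M : structure Sig) (w : M) (A : form) : Prop :=
  forall (M' : structure Sig) (f : M -> M'), embedding f -> forces (f w) A.

Definition Jsvi (Sig : signature) (X : nat -> Prop) (x : nat) : Prop :=
  exists A, [/\ sentence Sig A, x = fcode A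
    & forall (M : structure Sig) (w : M), (forall y, itp w y <-> X y) -> svi w A].

Definition fixed_point_SVI (Sig : signature) (M : structure Sig) : Prop :=
  forall (w : M) (x : nat), itp w x <-> Jsvi Sig (itp w) x.

(** * HA and HAT *)

(* Axiom schemes of intuitionistic predicate logic with equality and of
   arithmetic, closed under generalization, so that modus ponens is the only
   rule needed on sentences. *)
Inductive hat_scheme (Sig : signature) : form -> Prop :=
  | ax_K A B : hat_scheme Sig (Imp A (Imp B A))
  | ax_S A B C :
      hat_scheme Sig (Imp (Imp A (Imp B C)) (Imp (Imp A B) (Imp A C)))
  | ax_andI A B : hat_scheme Sig (Imp A (Imp B (And A B)))
  | ax_andEl A B : hat_scheme Sig (Imp (And A B) A)
  | ax_andEr A B : hat_scheme Sig (Imp (And A B) B)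
  | ax_orIl A B : hat_scheme Sig (Imp A (Or A B))
  | ax_orIr A B : hat_scheme Sig (Imp B (Or A B))
  | ax_orE A B C :
      hat_scheme Sig (Imp (Imp A C) (Imp (Imp B C) (Imp (Or A B) C)))
  | ax_botE A : hat_scheme Sig (Imp Bot A)
  | ax_allE v A t of free_for t v A :
      hat_scheme Sig (Imp (All v A) (fsubst v t A))
  | ax_exI v A t of free_for t v A :
      hat_scheme Sig (Imp (fsubst v t A) (Ex v A))
  | ax_all_dist v A B :
      hat_scheme Sig (Imp (All v (Imp A B)) (Imp (All v A) (All v B)))
  | ax_all_vac v A of v \notin fv A : hat_scheme Sig (Imp A (All v A))
  | ax_exE v A B of v \notin fv B :
      hat_scheme Sig (Imp (All v (Imp A B)) (Imp (Ex v A) B))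
  | ax_eq_refl t : hat_scheme Sig (Eq t t)
  | ax_eq_subst v A s t of free_for s v A & free_for t v A :
      hat_scheme Sig (Imp (Eq s t) (Imp (fsubst v s A) (fsubst v t A)))
  | ax_succ_neq0 s : hat_scheme Sig (Not (Eq (Succ s) Zero))
  | ax_succ_inj s t : hat_scheme Sig (Imp (Eq (Succ s) (Succ t)) (Eq s t))
  | ax_add0 s : hat_scheme Sig (Eq (Add s Zero) s)
  | ax_addS s t : hat_scheme Sig (Eq (Add s (Succ t)) (Succ (Add s t)))
  | ax_mul0 s : hat_scheme Sig (Eq (Mul s Zero) Zero)
  | ax_mulS s t : hat_scheme Sig (Eq (Mul s (Succ t)) (Add (Mul s t) s))
  | ax_ind v A :
      hat_scheme Sig
        (Imp (And (fsubst v Zero A) (All v (Imp A (fsubst v (Succ (Var v)) A))))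
             (All v A))
  | ax_expl i n t of i < size Sig & sdef Sig i = Expl n t :
      hat_scheme Sig (Eq (Fn i (map Var (iota 0 n))) t)
  | ax_rec0 i n b s of i < size Sig & sdef Sig i = Rec n b s :
      hat_scheme Sig (Eq (Fn i (rcons (map Var (iota 0 n)) Zero)) b)
  | ax_recS i n b s of i < size Sig & sdef Sig i = Rec n b s :
      hat_scheme Sig (Eq (Fn i (rcons (map Var (iota 0 n)) (Succ (Var n))))
                         (tsubst n.+1 (Fn i (map Var (iota 0 n.+1))) s))
  | ax_gen v A of hat_scheme Sig A : hat_scheme Sig (All v A).

Definition ax_HAT (Sig : signature) (A : form) : Prop :=
  hat_scheme Sig A /\ sentence Sig A.

Inductive HA_proves (Sig : signature) : form -> Prop :=
  | HA_ax A of ax_HAT Sig A & arith A : HA_proves Sig A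
  | HA_mp A B of HA_proves Sig (Imp A B) & HA_proves Sig A : HA_proves Sig B.

(** * Arithmetized syntax *)

Definition represents1 (Sig : signature) (S : form) (P : nat -> Prop) : Prop :=
  [/\ form_in Sig S, arith S, {subset fv S <= [:: 0]}
    & forall n,
        (P n -> HA_proves Sig (fsubst 0 (numeral n) S)) /\
        (~ P n -> HA_proves Sig (Not (fsubst 0 (numeral n) S)))].

Definition represents2 (Sig : signature) (S : form) (P : nat -> nat -> Prop) : Prop :=
  [/\ form_in Sig S, arith S, {subset fv S <= [:: 0; 1]}
    & forall m n,
        (P m n ->
           HA_proves Sig (fsubst 1 (numeral n) (fsubst 0 (numeral m) S))) /\
        (~ P m n ->
           HA_proves Sig (Not (fsubst 1 (numeral n) (fsubst 0 (numeral m) S))))].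

Definition symbol (Sig : signature) (i k : nat) : Prop :=
  i < size Sig /\ arity (sdef Sig i) = k.

Definition sfun (Sig : signature) (i : nat) (args : seq nat) : nat :=
  nth (fun=> 0) (interp Sig) i args.

(* The function symbols (given by their indices in the signature) for the
   operations on codes, and the formulas representing the syntactic predicates.
   The evaluation of closed terms has no function symbol in the language itself;
   [valF] represents its graph. *)
Record syntax : Type := Syntax {
  s_eq : nat; s_neq : nat; s_imp : nat; s_all : nat; s_tr : nat;
  s_sub : nat;  (* code of A, code of t, code of v |-> code of A(t/v) *)
  s_num : nat;  (* n |-> code of the numeral of n *)
  sentF : form; axF : form; ctermF : form;
  valF : form
}.

Record syntax_spec (Sig : signature) (P : syntax) : Prop := SyntaxSpec {
  s_eq_symbol : symbol Sig (s_eq P) 2;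
  s_eqE : forall x y, sfun Sig (s_eq P) [:: x; y] = c_eq x y;
  s_neq_symbol : symbol Sig (s_neq P) 2;
  s_neqE : forall x y, sfun Sig (s_neq P) [:: x; y] = c_neq x y;
  s_imp_symbol : symbol Sig (s_imp P) 2;
  s_impE : forall x y, sfun Sig (s_imp P) [:: x; y] = c_imp x y;
  s_all_symbol : symbol Sig (s_all P) 2;
  s_allE : forall v x, sfun Sig (s_all P) [:: v; x] = c_all v x;
  s_tr_symbol : symbol Sig (s_tr P) 1;
  s_trE : forall x, sfun Sig (s_tr P) [:: x] = c_tr x;
  s_sub_symbol : symbol Sig (s_sub P) 3;
  s_subE : forall A t v, form_in Sig A -> closed_term Sig t ->
    sfun Sig (s_sub P) [:: fcode A; tcode t; tcode (Var v)] = fcode (fsubst v t A);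
  s_num_symbol : symbol Sig (s_num P) 1;
  s_numE : forall n, sfun Sig (s_num P) [:: n] = tcode (numeral n);
  sentF_spec : represents1 Sig (sentF P) (SENT Sig);
  axF_spec : represents1 Sig (axF P) (fun x => exists2 A, ax_HAT Sig A & x = fcode A);
  ctermF_spec :
    represents1 Sig (ctermF P) (fun x => exists2 t, closed_term Sig t & x = tcode t);
  valF_spec :
    represents2 Sig (valF P)
      (fun x n => exists t, [/\ closed_term Sig t, x = tcode t & n = cvalue Sig t])
}.

(** * The theory ISV *)

Section Theory.
Variables (Sig : signature) (P : syntax).

(* The variables from [fresh] on differ from 0 and 1 and occur neither free nor
   bound in the representing formulas, so the substitutions below capture
   nothing. *)
Definition fresh : nat :=
  (maxn 1 (\max_(v <- all_vars (sentF P) ++ all_vars (axF P)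
                      ++ all_vars (ctermF P) ++ all_vars (valF P)) v)).+1.

Let x := fresh.
Let y := fresh.+1.
Let a := fresh.+2.
Let b := fresh.+3.

Definition Sent_ t := fsubst 0 t (sentF P).
Definition Ax_ t := fsubst 0 t (axF P).
Definition CTerm_ t := fsubst 0 t (ctermF P).
Definition Val_ t s := fsubst 1 s (fsubst 0 t (valF P)).

Definition eq_ s t := Fn (s_eq P) [:: s; t].
Definition neq_ s t := Fn (s_neq P) [:: s; t].
Definition imp_ s t := Fn (s_imp P) [:: s; t].
Definition all_ v t := Fn (s_all P) [:: v; t].
Definition tr_ t := Fn (s_tr P) [:: t].
Definition sub_ s t v := Fn (s_sub P) [:: s; t; v].
Definition num_ t := Fn (s_num P) [:: t].

Definition all_cterm v A := All v (Imp (CTerm_ (Var v)) A).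

Definition same_value s t :=
  Ex a (Ex b (And (And (Val_ s (Var a)) (Val_ t (Var b))) (Eq (Var a) (Var b)))).

Definition ISV1 : form :=
  all_cterm x (all_cterm y
    (And (Iff (Tr (eq_ (Var x) (Var y))) (same_value (Var x) (Var y)))
         (Iff (Tr (neq_ (Var x) (Var y))) (Not (same_value (Var x) (Var y)))))).

Definition ISV2 : form := All x (Imp (Ax_ (Var x)) (Tr (Var x))).

Definition ISV3 : form :=
  All x (All y
    (Imp (Sent_ (all_ (Var y) (Var x)))
         (Imp (all_cterm a (Tr (sub_ (Var x) (Var a) (Var y))))
              (Tr (all_ (Var y) (Var x)))))).

Definition ISV4 : form :=
  all_cterm x
    (Imp (Ex a (And (Val_ (Var x) (Var a)) (Tr (Var a)))) (Tr (tr_ (Var x)))).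

Definition ISV5 : form :=
  All x (All y
    (Imp (Sent_ (imp_ (Var x) (Var y)))
         (Imp (Tr (imp_ (Var x) (Var y))) (Imp (Tr (Var x)) (Tr (Var y)))))).

Definition ISV6 : form :=
  All x (Tr (sub_ (numeral (fcode (Imp (Tr (Var 0)) (Sent_ (Var 0)))))
                  (num_ (Var x))
                  (numeral (tcode (Var 0))))).

Definition ISV7 (A : form) : form := Imp (Tr (numeral (fcode A))) A.

Inductive ISV : form -> Prop :=
  | isv_HAT A of ax_HAT Sig A : ISV A
  | isv1 : ISV ISV1
  | isv2 : ISV ISV2
  | isv3 : ISV ISV3
  | isv4 : ISV ISV4
  | isv5 : ISV ISV5
  | isv6 : ISV ISV6
  | isv7 A of sentence Sig A : ISV (ISV7 A).

End Theory.

(* Main.v *)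
(* A world with interpretation X and any world of any structure whose
   interpretation includes X are linked by an embedding of the one-point
   structure with interpretation X.  So J_svi(X) consists of the sentences forced
   at all worlds whose interpretation includes X, and a fixed point is closed
   under whatever preserves this kind of validity: axioms of HAT, modus ponens,
   the omega-rule, Tr-introduction.  ISV7 is the case of the world itself.  The
   representing formulas of ISV1-ISV6 mean what they should at every world,
   because HA, being sound at all worlds, decides each numerical instance. *)

Require Import Defs.
From mathcomp Require Import all_boot.
From Stdlib Require Import Classical_Prop.

Set Implicit Arguments.
Unset Strict Implicit.
Unset Printing Implicit Defensive.

(* Otherwise simplification evaluates the codes of concrete sequences. *)
Local Opaque CodeSeq.code.
(* [all_boot] shadows this name with the projection of tuples. *)
Local Notation tval := Defs.tval.

(** * Terms and formulas *)

(** The generated principle says nothing about the arguments of [Fn]. Here they are covered by an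
    iterated conjunction, which an inner induction on the list can peel off. *)
Lemma tm_nested_ind (Q : tm -> Prop) :
  (forall v, Q (Var v)) -> Q Zero -> (forall s, Q s -> Q (Succ s)) ->
  (forall s t, Q s -> Q t -> Q (Add s t)) ->
  (forall s t, Q s -> Q t -> Q (Mul s t)) ->
  (forall i ts, foldr (fun t => and (Q t)) True ts -> Q (Fn i ts)) ->
  forall t, Q t.
Proof.
move=> HVar HZero HSucc HAdd HMul HFn; fix IH 1.
case=> [v||s|s t|s t|i ts];
  [exact: HVar|exact: HZero|exact: HSucc|exact: HAdd|exact: HMul|].
by apply: HFn; elim: ts => [|t ts IHts] //=; split.
Qed.

(** * Injectivity and inversion of the Gödel numbering *)

Lemma tcode_inj : injective tcode.
Proof.
have code_inj := can_inj CodeSeq.codeK.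
elim/tm_nested_ind=> [v||s IH|s1 s2 IH1 IH2|s1 s2 IH1 IH2|i ts IH]
  [u||t|t1 t2|t1 t2|j us] /= /code_inj //.
- by case=> ->.
- by case=> /IH ->.
- by case=> /IH1 -> /IH2 ->.
- by case=> /IH1 -> /IH2 ->.
- case=> <- eq_ts; congr Fn.
  elim: ts IH us eq_ts => [|t ts IHts] /= IH [|u us] //= [].
  by case: IH => IHt /IHts {}IHts /IHt -> /IHts ->.
Qed.

Lemma fcode_inj : injective fcode.
Proof.
have code_inj := can_inj CodeSeq.codeK.
elim=> [|s1 s2|s|A1 IH1 A2 IH2|A1 IH1 A2 IH2|A1 IH1 A2 IH2|v A IH|v A IH]
  [|t1 t2|t|B1 B2|B1 B2|B1 B2|u B|u B]
  /= /code_inj //.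
- by case=> /tcode_inj -> /tcode_inj ->.
- by case=> /tcode_inj ->.
- by case=> /IH1 -> /IH2 ->.
- by case=> /IH1 -> /IH2 ->.
- by case=> /IH1 -> /IH2 ->.
(* Entry 1 is the code of the bound variable, itself a coded list, so [code_inj] is applied once
   more; entry 2 is the code of the body. *)
- move=> /[dup] /(congr1 (nth 0 ^~ 1)) /= /code_inj [->].
  by move=> /(congr1 (nth 0 ^~ 2)) /= /IH ->.
- move=> /[dup] /(congr1 (nth 0 ^~ 1)) /= /code_inj [->].
  by move=> /(congr1 (nth 0 ^~ 2)) /= /IH ->.
Qed.

(** In ISV5 the object variables range over all numbers. Inverting the code of a sentence shows that
    the two components are codes of formulas; [fcode_eq_all] does the same for ISV3. *)
Lemma fcode_eq_imp A x y :
  fcode A = c_imp x y -> exists B C, [/\ A = Imp B C, x = fcode B & y = fcode C].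
Proof.
case: A => [|s t|s|B C|B C|B C|v B|v B] /= /(can_inj CodeSeq.codeK) // [<- <-].
by exists B, C.
Qed.

Lemma fcode_eq_all A x y :
  fcode A = c_all y x ->
  exists v B, [/\ A = All v B, y = tcode (Var v) & x = fcode B].
Proof.
case: A => [|s t|s|B C|B C|B C|v B|v B] /= /(can_inj CodeSeq.codeK) // [<- <-].
by exists v, B.
Qed.

(** * Numerals and substitution *)

Lemma fv_numeral n : fv_t (numeral n) = [::].
Proof. by elim: n. Qed.

Lemma term_in_numeral Sig n : term_in Sig (numeral n).
Proof. by elim: n. Qed.

Lemma closed_numeral Sig n : closed_term Sig (numeral n).
Proof. by rewrite /closed_term term_in_numeral fv_numeral. Qed.

Lemma tsubst_vac v r t : v \notin fv_t t -> tsubst v r t = t.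
Proof.
elim/tm_nested_ind: t => [u||s IH|s t IHs IHt|s t IHs IHt|i ts IH] //=.
- by rewrite inE eq_sym => /negbTE ->.
- by move=> /IH ->.
- by rewrite mem_cat negb_or => /andP[/IHs -> /IHt ->].
- by rewrite mem_cat negb_or => /andP[/IHs -> /IHt ->].
- move=> Hv; congr Fn.
  elim: ts IH Hv => [|t ts IHts] //= [IHt IH].
  by rewrite mem_cat negb_or => /andP[/IHt -> /(IHts IH) ->].
Qed.

Lemma fsubst_vac v r A : v \notin fv A -> fsubst v r A = A.
Proof.
elim: A => [|s t|s|B IHB C IHC|B IHB C IHC|B IHB C IHC|u B IH|u B IH] //=.
- by rewrite mem_cat negb_or => /andP[/tsubst_vac -> /tsubst_vac ->].
- by move=> /tsubst_vac ->.
- by rewrite mem_cat negb_or => /andP[/IHB -> /IHC ->].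
- by rewrite mem_cat negb_or => /andP[/IHB -> /IHC ->].
- by rewrite mem_cat negb_or => /andP[/IHB -> /IHC ->].
- by rewrite mem_filter eq_sym; case: eqP => //= _ /IH ->.
- by rewrite mem_filter eq_sym; case: eqP => //= _ /IH ->.
Qed.

Lemma tsubst_id v t : tsubst v (Var v) t = t.
Proof.
elim/tm_nested_ind: t => [u||s IH|s t IHs IHt|s t IHs IHt|i ts IH] //=.
- by case: eqP => // ->.
- by rewrite IH.
- by rewrite IHs IHt.
- by rewrite IHs IHt.
- by congr Fn; elim: ts IH => [|t ts IHts] //= [-> /IHts ->].
Qed.

Lemma fsubst_id v A : fsubst v (Var v) A = A.
Proof.
elim: A => [|s t|s|B IHB C IHC|B IHB C IHC|B IHB C IHC|u B IH|u B IH] //=;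
  rewrite ?tsubst_id ?IHB ?IHC ?IH //; by case: eqP.
Qed.

Lemma fv_tsubst v r t :
  fv_t r = [::] -> fv_t (tsubst v r t) = [seq u <- fv_t t | u != v].
Proof.
move=> Hr.
elim/tm_nested_ind: t => [u||s IH|s t IHs IHt|s t IHs IHt|i ts IH] //=.
- by case: eqP => //=; rewrite Hr.
- by rewrite filter_cat IHs IHt.
- by rewrite filter_cat IHs IHt.
- by elim: ts IH => [|t ts IHts] //= [IHt /IHts ->]; rewrite filter_cat IHt.
Qed.

Lemma fv_fsubst v r A :
  fv_t r = [::] -> fv (fsubst v r A) = [seq u <- fv A | u != v].
Proof.
move=> Hr; have binder u (s : seq nat) :
    [seq z <- [seq z <- s | z != v] | z != u] =
    [seq z <- [seq z <- s | z != u] | z != v].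
  by rewrite -!filter_predI; apply: eq_filter => z /=; rewrite andbC.
elim: A => [|s t|s|B IHB C IHC|B IHB C IHC|B IHB C IHC|u B IH|u B IH] //=;
  rewrite ?filter_cat ?fv_tsubst ?IHB ?IHC //.
- case: eqP => [->|_] /=; last by rewrite IH binder.
  by rewrite -filter_predI; apply: eq_filter => z /=; rewrite andbb.
- case: eqP => [->|_] /=; last by rewrite IH binder.
  by rewrite -filter_predI; apply: eq_filter => z /=; rewrite andbb.
Qed.

Lemma term_in_tsubst Sig v r t :
  term_in Sig r -> term_in Sig t -> term_in Sig (tsubst v r t).
Proof.
move=> Hr.
elim/tm_nested_ind: t => [u||s IH|s t IHs IHt|s t IHs IHt|i ts IH] //=.
- by case: eqP.
- by move=> /andP[/IHs -> /IHt ->].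
- by move=> /andP[/IHs -> /IHt ->].
- rewrite size_map => /and3P[-> ->] /=.
  by elim: ts IH => [|t ts IHts] //= [IHt IH] /andP[/IHt -> /(IHts IH) ->].
Qed.

Lemma form_in_fsubst Sig v r A :
  term_in Sig r -> form_in Sig A -> form_in Sig (fsubst v r A).
Proof.
move=> Hr.
elim: A => [|s t|s|B IHB C IHC|B IHB C IHC|B IHB C IHC|u B IH|u B IH] //=.
- by move=> /andP[/(term_in_tsubst v Hr) -> /(term_in_tsubst v Hr) ->].
- exact: term_in_tsubst.
- by move=> /andP[/IHB -> /IHC ->].
- by move=> /andP[/IHB -> /IHC ->].
- by move=> /andP[/IHB -> /IHC ->].
- by case: eqP.
- by case: eqP.
Qed.

(** * Bound variables and avoidance of capture *)

Fixpoint bound_vars (A : form) : seq nat :=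
  match A with
  | Bot | Eq _ _ | Tr _ => [::]
  | And B C | Or B C | Imp B C => bound_vars B ++ bound_vars C
  | All v B | Ex v B => v :: bound_vars B
  end.

Lemma bound_vars_sub A : {subset bound_vars A <= all_vars A}.
Proof.
elim: A => [|s t|s|B IHB C IHC|B IHB C IHC|B IHB C IHC|u B IH|u B IH] //= z;
  try by rewrite !mem_cat => /orP[/IHB|/IHC] ->; rewrite ?orbT.
- by rewrite !inE => /orP[|/IH] ->; rewrite ?orbT.
- by rewrite !inE => /orP[|/IH] ->; rewrite ?orbT.
Qed.

Lemma bound_vars_fsubst v r A : bound_vars (fsubst v r A) = bound_vars A.
Proof.
elim: A => [|s t|s|B IHB C IHC|B IHB C IHC|B IHB C IHC|u B IH|u B IH] //=;
  by rewrite ?IHB ?IHC //; case: eqP => //= _; rewrite IH.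
Qed.

(** Substitution for [v] stops at a binder of [v], so an occurrence of [v] in [r] cannot be
    captured. The exception for [z = v] admits [Succ (Var v)] in the induction axiom. *)
Lemma free_for_disjoint r v A :
  (forall z, z \in fv_t r -> z != v -> z \notin bound_vars A) -> free_for r v A.
Proof.
have binder u B : (forall z, z \in fv_t r -> z != v -> z \notin u :: bound_vars B) ->
    (u == v) || (u \notin fv_t r).
  move=> H; case: eqP => //= /eqP uv; apply/negP => ur.
  by have := H _ ur uv; rewrite inE eqxx.
have tail u (s : seq nat) :
    (forall z, z \in fv_t r -> z != v -> z \notin u :: s) ->
    forall z, z \in fv_t r -> z != v -> z \notin s.
  by move=> H z zr zv; have := H z zr zv; rewrite inE negb_or => /andP[].
elim: A => [|s t|s|B IHB C IHC|B IHB C IHC|B IHB C IHC|u B IH|u B IH] //= H;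
  try by apply/andP; split; [apply: IHB|apply: IHC] => z zr zv;
    have := H z zr zv; rewrite mem_cat negb_or => /andP[].
- by case/orP: (binder _ _ H) => -> //=; rewrite (IH (tail _ _ H)) !orbT.
- by case/orP: (binder _ _ H) => -> //=; rewrite (IH (tail _ _ H)) !orbT.
Qed.

Lemma free_for_closed r v A : fv_t r = [::] -> free_for r v A.
Proof. by move=> Hr; apply: free_for_disjoint; rewrite Hr. Qed.

(** * Values of terms *)

Lemma upd_eq rho v n : upd rho v n v = n.
Proof. by rewrite /upd eqxx. Qed.

Lemma upd_lt rho v n u : u < v -> upd rho v n u = rho u.
Proof. by move=> uv; rewrite /upd ltn_eqF. Qed.

Lemma eq_tval F rho rho' t :
  {in fv_t t, rho =1 rho'} -> tval F rho t = tval F rho' t.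
Proof.
elim/tm_nested_ind: t => [u||s IH|s t IHs IHt|s t IHs IHt|i ts IH] //= H.
- by apply: H; rewrite inE.
- by rewrite IH.
- by rewrite IHs ?IHt // => z zin; apply: H; rewrite mem_cat zin ?orbT.
- by rewrite IHs ?IHt // => z zin; apply: H; rewrite mem_cat zin ?orbT.
- congr (nth _ _ _ _); elim: ts IH H => [|t ts IHts] //= [IHt IH] H.
  by rewrite IHt ?IHts // => z zin; apply: H; rewrite mem_cat zin ?orbT.
Qed.

Lemma tval_tsubst F rho v r t :
  tval F rho (tsubst v r t) = tval F (upd rho v (tval F rho r)) t.
Proof.
elim/tm_nested_ind: t => [u||s IH|s t IHs IHt|s t IHs IHt|i ts IH] //=.
- by rewrite /upd; case: eqP.
- by rewrite IH.
- by rewrite IHs IHt.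
- by rewrite IHs IHt.
- by congr (nth _ _ _ _); elim: ts IH => [|t ts IHts] //= [-> /IHts ->].
Qed.

Lemma value_numeral Sig rho n : value Sig rho (numeral n) = n.
Proof. by rewrite /value; elim: n => //= n ->. Qed.

(** * Interpretation of the function symbols and their defining equations *)

Lemma interp_rcons Sig d :
  interp (rcons Sig d) = rcons (interp Sig) (fdef_fun (interp Sig) d).
Proof. by rewrite /interp -cats1 foldl_cat. Qed.

Lemma size_interp Sig : size (interp Sig) = size Sig.
Proof.
by elim/last_ind: Sig => [|Sig d IH] //; rewrite interp_rcons !size_rcons IH.
Qed.

Lemma interp_take i Sig : interp (take i Sig) = take i (interp Sig).
Proof.
elim/last_ind: Sig => [|Sig d IH] //; rewrite interp_rcons -!cats1 !take_cat.
rewrite size_interp; case: ltnP => // Hi.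
by case: (i - size Sig) => [|k] /=; rewrite ?cats0 // !cats1 interp_rcons.
Qed.

Lemma nth_interp Sig i : i < size Sig ->
  nth (fun=> 0) (interp Sig) i = fdef_fun (interp (take i Sig)) (sdef Sig i).
Proof.
move=> Hi; rewrite -(nth_take _ (ltnSn i)) -interp_take.
rewrite (take_nth (Expl 0 Zero)) // interp_rcons nth_rcons size_interp.
by rewrite size_take Hi ltnn eqxx.
Qed.

(** Later definitions only append functions to the list. So the right side of a definition, which
    uses earlier symbols only, has the same value over the prefix as over the whole signature. *)
Lemma tval_interp_take Sig i rho t : term_in (take i Sig) t ->
  tval (interp (take i Sig)) rho t = value Sig rho t.
Proof.
rewrite /value.
elim/tm_nested_ind: t => [u||s IH|s t IHs IHt|s t IHs IHt|j ts IH] //=.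
- by move=> /IH ->.
- by move=> /andP[/IHs -> /IHt ->].
- by move=> /andP[/IHs -> /IHt ->].
- case/and3P=> Hj _ Hts; rewrite interp_take nth_take; last first.
    by apply: leq_trans Hj _; rewrite size_take; case: ltnP.
  rewrite -interp_take.
  congr (nth _ _ _ _); elim: ts IH Hts => [|t ts IHts] //= [IHt IH].
  by move=> /andP[/IHt -> /(IHts IH) ->].
Qed.

Lemma map_tval_vars F rho n : map (tval F rho) (map Var (iota 0 n)) = map rho (iota 0 n).
Proof. by rewrite -map_comp. Qed.

Lemma nth_map_iota rho n v : v < n -> nth 0 (map rho (iota 0 n)) v = rho v.
Proof. by move=> Hv; rewrite (nth_map 0) ?size_iota // nth_iota. Qed.

Lemma value_expl Sig rho i n t : wf_signature Sig -> i < size Sig ->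
  sdef Sig i = Expl n t ->
  value Sig rho (Fn i (map Var (iota 0 n))) = value Sig rho t.
Proof.
move=> hSig Hi Hd; have := hSig i Hi; rewrite Hd => /= /andP[Ht /allP Hv].
rewrite /value /= nth_interp // Hd /= tval_interp_take //.
by apply: eq_tval => v /Hv Hlt; rewrite map_tval_vars nth_map_iota.
Qed.

Lemma value_rec Sig rho i n b s t : wf_signature Sig -> i < size Sig ->
  sdef Sig i = Rec n b s ->
  value Sig rho (Fn i (rcons (map Var (iota 0 n)) t)) =
  iteri (value Sig rho t)
    (fun y r => value Sig (upd (upd rho n y) n.+1 r) s) (value Sig rho b).
Proof.
move=> hSig Hi Hd; have := hSig i Hi; rewrite Hd => /= /and4P[Hb /allP Hvb Hs /allP Hvs].
rewrite /value /= nth_interp // Hd /= map_rcons map_tval_vars.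
have sz : size (map rho (iota 0 n)) = n by rewrite size_map size_iota.
rewrite nth_rcons sz ltnn eqxx -cats1 take_cat sz ltnn subnn cats0.
have -> : tval (interp (take i Sig)) (nth 0 (map rho (iota 0 n))) b =
          tval (interp Sig) rho b.
  rewrite tval_interp_take //; apply: eq_tval => v /Hvb Hlt.
  by rewrite nth_map_iota.
elim: (tval _ rho t) => [|k IH] //=; rewrite IH tval_interp_take //.
apply: eq_tval => v /Hvs Hv; rewrite nth_cat sz [RHS]/upd.
(* The step term sees parameters below [n], the recursion counter at [n] and the previous value at
   [n.+1]. *)
case: (ltngtP v n) => [Hlt|Hgt|->].
- by rewrite nth_map_iota // /upd !ltn_eqF // ltnW.
- have -> : v = n.+1 by apply/eqP; rewrite eqn_leq Hgt andbT -ltnS.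
  by rewrite eqxx subSnn.
- by rewrite subnn ltn_eqF //= /upd eqxx.
Qed.

Lemma value_rec0 Sig rho i n b s : wf_signature Sig -> i < size Sig ->
  sdef Sig i = Rec n b s ->
  value Sig rho (Fn i (rcons (map Var (iota 0 n)) Zero)) = value Sig rho b.
Proof. by move=> hSig Hi Hd; rewrite (value_rec _ _ hSig Hi Hd). Qed.

Lemma value_recS Sig rho i n b s : wf_signature Sig -> i < size Sig ->
  sdef Sig i = Rec n b s ->
  value Sig rho (Fn i (rcons (map Var (iota 0 n)) (Succ (Var n)))) =
  value Sig rho (tsubst n.+1 (Fn i (map Var (iota 0 n.+1))) s).
Proof.
move=> hSig Hi Hd; rewrite [RHS]/value tval_tsubst.
(* In this form [value_rec] also applies to the inner term, the recursive call. *)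
have -> : map Var (iota 0 n.+1) = rcons (map Var (iota 0 n)) (Var n).
  by rewrite -addn1 iotaD map_cat cats1.
rewrite -/(value Sig rho _) !(value_rec _ _ hSig Hi Hd) /=.
(* The last unfolding of [iteri] sets variable [n] to [rho n], which changes nothing. *)
by apply: eq_tval => v _; rewrite /upd; case: eqP => // _; case: eqP => // ->.
Qed.

(** * Forcing *)

Section Forcing.
Variables (Sig : signature) (M : structure Sig).
Implicit Types (w : M) (A : form).

Lemma forces_mono w w' rho A : wle w w' -> forces_at w rho A -> forces_at w' rho A.
Proof.
elim: A w w' rho => [|s t|s|B IHB C IHC|B IHB C IHC|B IHB C IHC|u B IH|u B IH]
  //= w w' rho le_w.
- exact: itp_persistent.
- by case=> /IHB HB /IHC HC; split; [apply: HB|apply: HC].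
- by case=> [/IHB HB|/IHC HC]; [left; apply: HB|right; apply: HC].
- by move=> H w2 le2; apply: H; apply: wle_trans le2.
- by move=> H w2 le2; apply: H; apply: wle_trans le2.
- by case=> n /IH H; exists n; apply: H.
Qed.

Lemma eq_forces w rho rho' A :
  {in fv A, rho =1 rho'} -> forces_at w rho A <-> forces_at w rho' A.
Proof.
have binder u (s : seq nat) (r r' : nat -> nat) n :
    {in [seq z <- s | z != u], r =1 r'} -> {in s, upd r u n =1 upd r' u n}.
  move=> H z zs; rewrite /upd; case: eqP => // /eqP zu.
  by apply: H; rewrite mem_filter zu.
have catl (s s' : seq nat) (r r' : nat -> nat) :
    {in s ++ s', r =1 r'} -> {in s, r =1 r'} /\ {in s', r =1 r'}.
  by move=> H; split=> z zs; apply: H; rewrite mem_cat zs ?orbT.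
elim: A w rho rho' => [|s t|s|B IHB C IHC|B IHB C IHC|B IHB C IHC|u B IH|u B IH]
  //= w rho rho'.
- by move=> /catl[Hs Ht]; rewrite /value (eq_tval _ Hs) (eq_tval _ Ht).
- by move=> Hs; rewrite /value (eq_tval _ Hs).
- by move=> /catl[HB HC]; rewrite (IHB _ _ _ HB) (IHC _ _ _ HC).
- by move=> /catl[HB HC]; rewrite (IHB _ _ _ HB) (IHC _ _ _ HC).
- move=> /catl[HB HC]; split=> H w' le_w /(IHB _ _ _ HB) Hf;
    by apply/(IHC _ _ _ HC)/H.
- move=> /binder HB; split=> H w' le_w n;
    by apply/(IH _ _ _ (HB n))/H.
- by move=> /binder HB; split=> - [n /(IH _ _ _ (HB n)) Hn]; exists n.
Qed.

(** Under a binder of [u] there are three cases. If [u = v], the inner update shadows the outer one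
    ([shadow]); if [v] is not free in the body, neither side depends on it ([vac]); otherwise [u]
    does not occur in [r], whose value is then unaffected, and the two updates commute ([swap]). *)
Lemma forces_fsubst w rho v r A : free_for r v A ->
  forces_at w rho (fsubst v r A) <-> forces_at w (upd rho v (value Sig rho r)) A.
Proof.
have shadow (u n m : nat) (r0 : nat -> nat) : upd (upd r0 u m) u n =1 upd r0 u n.
  by move=> z; rewrite /upd; case: eqP.
have vac u n B r0 w0 : v \notin fv B -> u != v ->
    forces_at w0 (upd r0 u n) (fsubst v r B) <->
    forces_at w0 (upd (upd r0 v (value Sig r0 r)) u n) B.
  move=> vB uv; rewrite fsubst_vac //; apply: eq_forces => z zB.
  by rewrite /upd; case: (z =P v) => // zv; rewrite -zv zB in vB.
have swap u n B r0 w0 : u \notin fv_t r -> u != v ->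
    forces_at w0 (upd (upd r0 u n) v (value Sig (upd r0 u n) r)) B <->
    forces_at w0 (upd (upd r0 v (value Sig r0 r)) u n) B.
  move=> ur uv; have -> : value Sig (upd r0 u n) r = value Sig r0 r.
    apply: eq_tval => z zr; rewrite /upd; case: eqP => // zu.
    by rewrite -zu zr in ur.
  apply: eq_forces => z _; rewrite /upd; case: (z =P v) => // ->.
  by rewrite eq_sym (negbTE uv).
elim: A w rho => [|s t|s|B IHB C IHC|B IHB C IHC|B IHB C IHC|u B IH|u B IH]
  //= w rho.
- by rewrite /value !tval_tsubst.
- by rewrite /value !tval_tsubst.
- by case/andP=> fB fC; rewrite IHB // IHC.
- by case/andP=> fB fC; rewrite IHB // IHC.
- by case/andP=> fB fC; split=> H w' le_w /(IHB _ _ fB) Hf; apply/(IHC _ _ fC)/H.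
- case: eqP => [-> _|/eqP uv /= ff].
    by split=> H w' le_w n; apply/(eq_forces _ (in1W (shadow _ _ _ _)))/H.
  have key n w' : forces_at w' (upd rho u n) (fsubst v r B) <->
      forces_at w' (upd (upd rho v (value Sig rho r)) u n) B.
    by case/orP: ff => [vB|/andP[ur fB]]; [apply: vac|rewrite IH // swap].
  by split=> H w' le_w n; apply/key/H.
- case: eqP => [-> _|/eqP uv /= ff].
    by split=> - [n Hn]; exists n; move: Hn;
      rewrite (eq_forces _ (in1W (shadow _ _ _ _))).
  have key n w' : forces_at w' (upd rho u n) (fsubst v r B) <->
      forces_at w' (upd (upd rho v (value Sig rho r)) u n) B.
    by case/orP: ff => [vB|/andP[ur fB]]; [apply: vac|rewrite IH // swap].
  by split=> - [n /key Hn]; exists n.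
Qed.

Hypothesis hSig : wf_signature Sig.

(** Quantifying over all worlds and assignments is what carries the induction through [ax_gen]. *)
Lemma forces_hat_scheme A : hat_scheme Sig A -> forall w rho, forces_at w rho A.
Proof.
elim=> {A} [A B|A B C|A B|A B|A B|A B|A B|A B C|A|v A t ff|v A t ff|v A B|v A vA
  |v A B vB|t|v A s t fs ft|s|s t|s|s t|s|s t|v A|i n t Hi Hd|i n b s Hi Hd
  |i n b s Hi Hd|v A _ IH] w rho.
- by move=> w1 _ HA w2 le2 _; apply: forces_mono HA.
- move=> w1 _ HABC w2 le2 HAB w3 le3 HA.
  apply: (HABC w3 _ HA w3 (wle_refl _)); first exact: wle_trans le3.
  exact: HAB.
- by move=> w1 _ HA w2 le2 HB; split; first exact: forces_mono HA.
- by move=> w1 _ [].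
- by move=> w1 _ [].
- by move=> w1 _ HA; left.
- by move=> w1 _ HB; right.
- move=> w1 _ HAC w2 le2 HBC w3 le3 [HA|HB]; last exact: HBC.
  by apply: HAC HA; apply: wle_trans le3.
- by move=> w1 _ [].
- move=> w1 _ HA; apply/forces_fsubst => //; apply: HA; exact: wle_refl.
- by move=> w1 _ /(forces_fsubst _ _ ff) HA; exists (value Sig rho t).
- move=> w1 _ HAB w2 le2 HA w3 le3 n; apply: (HAB w3 _ n w3 (wle_refl _)).
    exact: wle_trans le3.
  exact: HA.
- move=> w1 _ HA w2 le2 n; apply/(@eq_forces _ _ rho).
    by move=> z zA; rewrite /upd; case: eqP => // zv; rewrite -zv zA in vA.
  exact: forces_mono HA.
- move=> w1 _ HAB w2 le2 [n HA].
  have := HAB w2 le2 n w2 (wle_refl _) HA; apply: (iffLR (eq_forces _ _)).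
  by move=> z zB; rewrite /upd; case: eqP => // zv; rewrite -zv zB in vB.
- by [].
- move=> w1 _ /= Est w2 le2 /(forces_fsubst _ _ fs) HA.
  by apply/(forces_fsubst _ _ ft); rewrite -Est.
- by move=> w1 _.
- by move=> w1 _ [].
- by rewrite /= /value /= addn0.
- by rewrite /= /value /= addnS.
- by rewrite /= /value /= muln0.
- by rewrite /= /value /= mulnSr.
(* All domains are the standard numbers, so induction on [n] at the fixed world [w2] suffices. *)
- move=> w1 _ [HA0 HAS] w2 le2 n; elim: n => [|n IHn].
    have : forces_at w2 rho (fsubst v Zero A) by apply: forces_mono HA0.
    by rewrite forces_fsubst //; apply: free_for_closed.
  have : forces_at w2 (upd rho v n) (fsubst v (Succ (Var v)) A).
    exact: (HAS w2 le2 n w2 (wle_refl _) IHn).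
  rewrite forces_fsubst; last first.
    by apply: free_for_disjoint => z; rewrite inE => /eqP ->; rewrite eqxx.
  apply: (iffLR (eq_forces _ _)) => z _.
  by rewrite /upd /value /=; case: eqP => //; rewrite eqxx.
- exact: (value_expl _ hSig Hi Hd).
- exact: (value_rec0 _ hSig Hi Hd).
- exact: (value_recS _ hSig Hi Hd).
- by move=> w1 _ n; apply: IH.
Qed.

Lemma models_ax_HAT A : ax_HAT Sig A -> models M A.
Proof. by case=> HA _ w; apply: forces_hat_scheme. Qed.

Lemma HA_sound A : HA_proves Sig A -> models M A.
Proof.
elim=> {A} [A /models_ax_HAT //|A B _ HAB _ HA] w.
by apply: HAB (wle_refl _) _; apply: HA.
Qed.

(** If [A] is forced but [Q] fails, then HA refutes [A], and soundness gives a contradiction at [w].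
    Excluded middle for [Q] is used here. *)
Lemma decided_forces w (Q : Prop) A :
  (Q -> HA_proves Sig A) /\ (~ Q -> HA_proves Sig (Not A)) -> forces w A <-> Q.
Proof.
case=> HQ HnQ; split=> [HA|/HQ /HA_sound]; last exact.
apply: NNPP => /HnQ /HA_sound /(_ w w (wle_refl w)); exact.
Qed.

(** Variable 0 is the only one that can be free in [S], so substituting [t] amounts to substituting
    the numeral of its value, and that instance is decided by HA. *)
Lemma represents1_forces S Q : represents1 Sig S Q ->
  forall w rho t, free_for t 0 S ->
  forces_at w rho (fsubst 0 t S) <-> Q (value Sig rho t).
Proof.
case=> _ _ fvS HQ w rho t ff.
rewrite forces_fsubst // -(decided_forces w (HQ _)) /forces.
rewrite forces_fsubst; last by rewrite free_for_closed ?fv_numeral.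
apply: eq_forces => z /fvS; rewrite inE => /eqP ->.
by rewrite /upd eqxx value_numeral.
Qed.

(** The substitutions are successive, so variable 1 must not occur in [t], where the second one
    would replace it. *)
Lemma represents2_forces S Q : represents2 Sig S Q ->
  forall w rho t s, free_for t 0 S -> free_for s 1 (fsubst 0 t S) -> 1 \notin fv_t t ->
  forces_at w rho (fsubst 1 s (fsubst 0 t S)) <->
  Q (value Sig rho t) (value Sig rho s).
Proof.
case=> _ _ fvS HQ w rho t s ft fs t1.
have vt : value Sig (upd rho 1 (value Sig rho s)) t = value Sig rho t.
  by apply: eq_tval => z zt; rewrite /upd; case: eqP => // z1; rewrite -z1 zt in t1.
rewrite -(decided_forces w (HQ _ _)) /forces !forces_fsubst ?vt //;
  try by rewrite free_for_closed ?fv_numeral.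
apply: eq_forces => z /fvS; rewrite !inE /upd !value_numeral.
by case/orP=> /eqP ->.
Qed.

End Forcing.

(** * Supervaluation *)

Section OnePoint.
Variables (Sig : signature) (X : nat -> Prop) (HX : forall x, X x -> SENT Sig x).

Definition one_point : structure Sig :=
  @Structure Sig unit (fun _ _ => True) (fun _ => I) (fun _ _ _ _ _ => I)
    (fun u v _ _ => match u, v with tt, tt => erefl end)
    (fun _ => X) (fun _ => @HX) (fun _ _ _ _ Xx => Xx).

Lemma JsviP x :
  Jsvi Sig X x <->
  exists A, [/\ sentence Sig A, x = fcode A
    & forall (M : structure Sig) (w : M), (forall y, X y -> itp w y) -> forces w A].
Proof.
split=> - [A [sA -> HA]]; exists A; split=> //.
(* The constant map at [w] embeds [one_point]: injectivity is trivial and the order condition is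
   reflexivity at [w]. *)
- move=> M w Xw; apply: (HA one_point tt _ M (fun=> w)) => //; split=> //=.
  + by move=> [] [].
  + by move=> u v; split=> // _; apply: wle_refl.
(* An embedding only enlarges interpretations, so [f w] still includes [X]. *)
- move=> M w Xw M' f [_ _ Hf]; apply: HA => y /Xw; exact: Hf.
Qed.

End OnePoint.

(** * Closure properties of fixed points *)

Section FixedPoint.
Variables (Sig : signature) (M : structure Sig) (hM : fixed_point_SVI M).

(** Injectivity of [fcode] identifies the sentence provided by [JsviP] with [A]. *)
Lemma fixed_pointP (w : M) A :
  itp w (fcode A) <->
  sentence Sig A /\ forall (M' : structure Sig) (w' : M'),
    (forall y, itp w y -> itp w' y) -> forces w' A.
Proof.
rewrite (hM w _) (JsviP (@itp_sent _ _ w)); split=> [[B []]|[sA HA]].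
  by move=> sB /fcode_inj -> HB.
by exists A.
Qed.

Lemma itp_forces (w : M) A : itp w (fcode A) -> forces w A.
Proof. by case/fixed_pointP=> _; apply. Qed.

Lemma itp_eq (w : M) s t : closed_term Sig s -> closed_term Sig t ->
  itp w (fcode (Eq s t)) <-> cvalue Sig s = cvalue Sig t.
Proof.
move=> /andP[ins /eqP fs] /andP[int /eqP ft]; split=> [/itp_forces //|st].
by apply/fixed_pointP; rewrite /sentence /= ins int fs ft.
Qed.

Lemma itp_neq (w : M) s t : closed_term Sig s -> closed_term Sig t ->
  itp w (fcode (Not (Eq s t))) <-> cvalue Sig s <> cvalue Sig t.
Proof.
move=> /andP[ins /eqP fs] /andP[int /eqP ft]; split=> [/itp_forces|st].
  by move=> H /(H w (wle_refl _)).
apply/fixed_pointP; rewrite /sentence /= ins int fs ft; split=> // M' w' _ w2 _.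
exact: st.
Qed.

Lemma itp_tr (w : M) t : closed_term Sig t -> itp w (cvalue Sig t) ->
  itp w (fcode (Tr t)).
Proof.
move=> /andP[int /eqP ft] wt; apply/fixed_pointP; rewrite /sentence /= int ft.
by split=> // M' w'; apply.
Qed.

Lemma itp_mp (w : M) A B :
  itp w (fcode (Imp A B)) -> itp w (fcode A) -> itp w (fcode B).
Proof.
move=> /fixed_pointP[sAB HAB] /fixed_pointP[_ HA]; apply/fixed_pointP; split.
  move: sAB; rewrite /sentence /= => /andP[/andP[_ ->]].
  by case: (fv A) => //= /eqP ->.
by move=> M' w' Hw; apply: (HAB M' w' Hw w' (wle_refl _)); apply: HA.
Qed.

(** The omega-rule: each numerical instance is forced at every [w'] including [w], persists to later
    worlds, and the numerals exhaust the domain. *)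
Lemma itp_all (w : M) v A : sentence Sig (All v A) ->
  (forall n, itp w (fcode (fsubst v (numeral n) A))) -> itp w (fcode (All v A)).
Proof.
move=> sA HA; apply/fixed_pointP; split=> // M' w' Hw w2 le2 n.
case/fixed_pointP: (HA n) => _ /(_ M' w' Hw) /(forces_mono le2).
rewrite forces_fsubst ?value_numeral //.
by rewrite free_for_closed ?fv_numeral.
Qed.

End FixedPoint.

(** * The axioms of ISV *)

Section Soundness.
Variables (Sig : signature) (hSig : wf_signature Sig).
Variables (P : syntax) (hP : syntax_spec Sig P).

Lemma fresh_gt1 : 1 < fresh P.
Proof. by rewrite ltnS leq_maxl. Qed.

Lemma fresh_notin z :
  fresh P <= z ->
  z \notin all_vars (sentF P) ++ all_vars (axF P)
             ++ all_vars (ctermF P) ++ all_vars (valF P).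
Proof.
move=> Hz; apply/negP => zin; move: Hz; rewrite ltnNge => /negP; apply.
by rewrite leq_max (leq_bigmax_seq _ zin) ?orbT.
Qed.

Lemma free_for_fresh S t v :
  {subset bound_vars S <= all_vars (sentF P) ++ all_vars (axF P)
                          ++ all_vars (ctermF P) ++ all_vars (valF P)} ->
  all (leq (fresh P)) (fv_t t) -> free_for t v S.
Proof.
move=> HS /allP Ht; apply: free_for_disjoint => z /Ht /fresh_notin + _.
by apply: contra => /HS.
Qed.

Variable M : structure Sig.

Lemma forces_Sent (w : M) rho t : all (leq (fresh P)) (fv_t t) ->
  forces_at w rho (Sent_ P t) <-> SENT Sig (value Sig rho t).
Proof.
move=> Ht; apply: (represents1_forces hSig (sentF_spec hP)).
by apply: free_for_fresh Ht => z /bound_vars_sub; rewrite !mem_cat => ->; rewrite ?orbT.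
Qed.

Lemma forces_Ax (w : M) rho t : all (leq (fresh P)) (fv_t t) ->
  forces_at w rho (Ax_ P t) <->
  exists2 A, ax_HAT Sig A & value Sig rho t = fcode A.
Proof.
move=> Ht; apply: (represents1_forces hSig (axF_spec hP)).
by apply: free_for_fresh Ht => z /bound_vars_sub; rewrite !mem_cat => ->; rewrite ?orbT.
Qed.

Lemma forces_CTerm (w : M) rho t : all (leq (fresh P)) (fv_t t) ->
  forces_at w rho (CTerm_ P t) <->
  exists2 u, closed_term Sig u & value Sig rho t = tcode u.
Proof.
move=> Ht; apply: (represents1_forces hSig (ctermF_spec hP)).
by apply: free_for_fresh Ht => z /bound_vars_sub; rewrite !mem_cat => ->; rewrite ?orbT.
Qed.

(** A code determines its term, so the term provided by the representation of [valF] must be [u]. *)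
Lemma forces_Val (w : M) rho t s u :
  all (leq (fresh P)) (fv_t t) -> all (leq (fresh P)) (fv_t s) ->
  closed_term Sig u -> value Sig rho t = tcode u ->
  forces_at w rho (Val_ P t s) <-> value Sig rho s = cvalue Sig u.
Proof.
move=> Ht Hs Hu tu; rewrite (represents2_forces hSig (valF_spec hP)).
- split=> [[u' [Hu' + ->]]|->]; last by exists u.
  by rewrite tu => /tcode_inj ->.
- by apply: free_for_fresh Ht => z /bound_vars_sub; rewrite !mem_cat => ->; rewrite ?orbT.
- apply: free_for_fresh Hs => z; rewrite bound_vars_fsubst => /bound_vars_sub.
  by rewrite !mem_cat => ->; rewrite ?orbT.
- by apply/negP => /(allP Ht); rewrite leqNgt fresh_gt1.
Qed.

Lemma forces_Tr (w : M) rho t n :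
  value Sig rho t = n -> itp w n -> forces_at w rho (Tr t).
Proof. by move=> <-. Qed.

(** The quantifier and the implication each move to a later world; transitivity merges the two
    moves. *)
Lemma forces_all_cterm (w : M) rho v A : fresh P <= v ->
  forces_at w rho (all_cterm P v A) <->
  forall (w' : M) t, wle w w' -> closed_term Sig t ->
    forces_at w' (upd rho v (tcode t)) A.
Proof.
move=> Hv; have cv (w' : M) r : forces_at w' r (CTerm_ P (Var v)) <->
    exists2 u, closed_term Sig u & r v = tcode u.
  by rewrite forces_CTerm /= ?Hv.
split=> [H w' t le_w ct|H w1 le1 n w2 le2 /cv[t ct]].
  by apply: (H w' le_w (tcode t) w' (wle_refl _)); apply/cv; exists t; rewrite ?upd_eq.
by rewrite upd_eq => ->; apply: H => //; apply: wle_trans le2.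
Qed.

(** The bounds on [u] and [v] keep them below the witness variables [a] and [b], whose updates
    therefore leave the codes of [s] and [t] intact. *)
Lemma forces_same_value (w : M) rho u v s t :
  fresh P <= u < (fresh P).+2 -> fresh P <= v < (fresh P).+2 ->
  closed_term Sig s -> closed_term Sig t -> rho u = tcode s -> rho v = tcode t ->
  forces_at w rho (same_value P (Var u) (Var v)) <-> cvalue Sig s = cvalue Sig t.
Proof.
move=> /andP[Hu ua] /andP[Hv va] cs ct us vt.
set a := (fresh P).+2; set b := (fresh P).+3.
have ab : a < b by apply: ltnSn.
have aP : fresh P <= a := leqW (leqnSn _).
have bP : fresh P <= b := leqW aP.
pose r m n := upd (upd rho a m) b n.
have ra m n : r m n a = m by rewrite /r upd_lt // upd_eq.
have rb m n : r m n b = n by rewrite /r upd_eq.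
have Vs m n : forces_at w (r m n) (Val_ P (Var u) (Var a)) <-> m = cvalue Sig s.
  rewrite -[X in _ <-> X = _](ra m n); apply: forces_Val; rewrite /= ?Hu ?aP //.
  by rewrite /value /= /r !upd_lt // ltnW.
have Vt m n : forces_at w (r m n) (Val_ P (Var v) (Var b)) <-> n = cvalue Sig t.
  rewrite -[X in _ <-> X = _](rb m n); apply: forces_Val; rewrite /= ?Hv ?bP //.
  by rewrite /value /= /r !upd_lt // ltnW.
have eq_ab m n : forces_at w (r m n) (Eq (Var a) (Var b)) <-> m = n.
  by rewrite -[X in _ <-> X = _](ra m n) -[X in _ <-> _ = X](rb m n).
split=> [[m [n [[/Vs -> /Vt ->]]]] /eq_ab //|st].
by exists (cvalue Sig s), (cvalue Sig t); split; [split; [apply/Vs|apply/Vt]|apply/eq_ab].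
Qed.

Hypothesis hM : fixed_point_SVI M.

Lemma models_ISV1 : models M (ISV1 P).
Proof.
move=> w; rewrite /forces /ISV1; cbv zeta.
apply/forces_all_cterm => // w1 s _ cs; apply/forces_all_cterm => // w2 t _ ct.
set rho := upd _ _ _.
have rx : rho (fresh P) = tcode s by rewrite /rho upd_lt // upd_eq.
have ry : rho (fresh P).+1 = tcode t by rewrite /rho upd_eq.
(* The right sides of these equivalences do not depend on the world, so they can be used at the
   later worlds where the implications of ISV1 are evaluated. *)
have sv (w3 : M) : forces_at w3 rho (same_value P (Var (fresh P)) (Var (fresh P).+1)) <->
    cvalue Sig s = cvalue Sig t.
  by apply: forces_same_value; rewrite ?leqnn ?leqnSn ?ltnSn ?ltnS ?leqnSn.
have eqE (w3 : M) : forces_at w3 rho (Tr (eq_ P (Var (fresh P)) (Var (fresh P).+1))) <->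
    cvalue Sig s = cvalue Sig t.
  by rewrite -(itp_eq hM w3 cs ct) /= -rx -ry -(s_eqE hP).
have neqE (w3 : M) : forces_at w3 rho (Tr (neq_ P (Var (fresh P)) (Var (fresh P).+1))) <->
    cvalue Sig s <> cvalue Sig t.
  by rewrite -(itp_neq hM w3 cs ct) /= -rx -ry -/(c_neq _ _) -(s_neqE hP).
split; split=> w3 le3.
- by move=> /eqE st; apply/(sv w3).
- by move=> /sv st; apply/eqE.
- by move=> /neqE st w4 le4 /sv.
- by move=> H; apply/neqE => /(sv w3) st; apply: (H w3 (wle_refl _) st).
Qed.

Lemma models_ISV2 : models M (ISV2 P).
Proof.
move=> w; rewrite /forces /ISV2; cbv zeta => w1 _ n w2 _.
rewrite -/(forces_at w2 _ (Ax_ P _)) forces_Ax /= ?leqnn // => - [A HA ->].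
apply/(fixed_pointP hM); split; first by case: HA.
by move=> M' w' _; apply: models_ax_HAT.
Qed.

Lemma models_ISV3 : models M (ISV3 P).
Proof.
move=> w; rewrite /forces /ISV3; cbv zeta => w1 _ m w2 _ n w3 _.
set rho := upd _ _ _.
have rx : rho (fresh P) = m by rewrite /rho upd_lt // upd_eq.
have ry : rho (fresh P).+1 = n by rewrite /rho upd_eq.
have allE : value Sig rho (all_ P (Var (fresh P).+1) (Var (fresh P))) = c_all n m.
  by rewrite -rx -ry -(s_allE hP).
move=> HS; have [|A sA /esym] := (forces_Sent w3 rho _).1 HS.
  by rewrite /= leqnn leqnSn.
rewrite allE => /fcode_eq_all[v [B [EA En Em]]] w4 _ H.
have {}H := (forces_all_cterm w4 rho
  (Tr (sub_ P (Var (fresh P)) (Var (fresh P).+2) (Var (fresh P).+1)))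
  (leqW (leqnSn _))).1 H.
rewrite En Em -/(fcode (All v B)).
apply: (itp_all hM); first by rewrite -EA.
(* Among the closed terms allowed by the premise, the numerals suffice for [itp_all]. *)
move=> k; have B_in : form_in Sig B by move: sA; rewrite EA => /andP[].
rewrite -(s_subE hP v B_in (closed_numeral Sig k)) -Em -En.
have := H w4 (numeral k) (wle_refl _) (closed_numeral _ _).
by rewrite /= /value /= upd_eq !upd_lt // rx ry.
Qed.

Lemma models_ISV4 : models M (ISV4 P).
Proof.
move=> w; rewrite /forces /ISV4; cbv zeta.
apply/forces_all_cterm => // w1 t _ ct w2 _ [n [Hval Htr]].
set x := fresh P in Hval Htr *; set a := x.+2 in Hval Htr.
pose rho := upd (fun=> 0) x (tcode t); pose rho' := upd rho a n.
have rx : rho x = tcode t by rewrite /rho upd_eq.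
have rx' : rho' x = tcode t by rewrite /rho' upd_lt.
have ra : rho' a = n by rewrite /rho' upd_eq.
(* [Val_] pins the existential witness down to the value of [t]. *)
have En : n = cvalue Sig t.
  rewrite -ra; apply/(@forces_Val w2 rho' (Var x) (Var a) t) => //=.
    by rewrite leqnn.
  by rewrite (leqW (leqnSn _)).
have trE : value Sig rho (tr_ P (Var x)) = fcode (Tr t) by rewrite /= -rx -(s_trE hP).
apply: (forces_Tr trE); apply: (itp_tr hM) => //.
by rewrite -En -ra.
Qed.

Lemma models_ISV5 : models M (ISV5 P).
Proof.
move=> w; rewrite /forces /ISV5; cbv zeta => w1 _ m w2 _ n w3 _.
set rho := upd _ _ _.
have rx : rho (fresh P) = m by rewrite /rho upd_lt // upd_eq.
have ry : rho (fresh P).+1 = n by rewrite /rho upd_eq.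
have impE : value Sig rho (imp_ P (Var (fresh P)) (Var (fresh P).+1)) = c_imp m n.
  by rewrite -rx -ry -(s_impE hP).
move=> HS; have [|A sA /esym] := (forces_Sent w3 rho _).1 HS.
  by rewrite /= leqnn leqnSn.
rewrite impE => /fcode_eq_imp[B [C [EA Em En]]] w4 _ HBC w5 le5 HB.
(* The conditional is true at [w4] and its antecedent at the later world [w5], where modus ponens is
   applied. *)
have {}HBC : itp w5 (c_imp m n) := itp_persistent le5 HBC.
apply: (forces_Tr (t := Var _) ry); rewrite En; apply: (itp_mp hM (A := B)).
  by rewrite /= -Em -En.
by rewrite -Em -rx.
Qed.

Lemma models_ISV6 : models M (ISV6 P).
Proof.
have [S_in _ fvS _] := sentF_spec hP.
rewrite /ISV6 /Sent_ fsubst_id; set S := Imp _ _.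
have inS : form_in Sig S by [].
move=> w w1 _ n; set rho := upd _ _ _.
have subE : value Sig rho (sub_ P (numeral (fcode S)) (num_ P (Var (fresh P)))
    (numeral (tcode (Var 0)))) = fcode (fsubst 0 (numeral n) S).
  (* The code of the instance becomes a value of the substitution function, whose arguments are then
     written as values of the terms inside [sub_]. *)
  rewrite -(s_subE hP _ inS (closed_numeral Sig n)) -(s_numE hP).
  rewrite -[in RHS](value_numeral Sig rho (fcode S)).
  rewrite -[in RHS](value_numeral Sig rho (tcode (Var 0))).
  by rewrite -[in RHS](upd_eq (fun=> 0) (fresh P) n).
apply: (forces_Tr subE); apply/(fixed_pointP hM); split.
  rewrite /sentence form_in_fsubst ?term_in_numeral // fv_fsubst ?fv_numeral //=.
  rewrite (eq_in_filter (a2 := pred0)) ?filter_pred0 // => z /fvS.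
  by rewrite inE => /eqP ->.
(* Interpretations contain only codes of sentences, in every structure, so the conditional is forced
   everywhere. *)
move=> M' w' _ w2 _ /itp_sent Hn.
apply/(represents1_forces hSig (sentF_spec hP)) => //.
by rewrite free_for_closed ?fv_numeral.
Qed.

Lemma models_ISV7 A : models M (ISV7 A).
Proof.
move=> w w1 _; rewrite /= value_numeral; exact: (itp_forces hM).
Qed.

End Soundness.

Theorem theorem1 (Sig : signature) (hSig : wf_signature Sig)
    (P : syntax) (hP : syntax_spec Sig P)
    (M : structure Sig) (hM : fixed_point_SVI M)
    (A : form) (hA : ISV Sig P A) : models M A.
Proof.
case: hA => [{}A HA|||||||{}A _].
- exact: models_ax_HAT HA.
- exact: models_ISV1.
- exact: models_ISV2.
- exact: models_ISV3.
- exact: models_ISV4.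
- exact: models_ISV5.
- exact: models_ISV6.
- exact: models_ISV7.
Qed.
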